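(* Let $m\ge 2$, let $\vec z\in\mathbb{R}^m$ with $\|\vec z\|=1$, and let $y^{\text{mode}}\in\{1,\dots,m\}$ be an index at which $\vec z$ attains its maximum coordinate. Let $\alpha_s,\alpha_t>0$ be such that $\gamma:=\alpha_t/\alpha_s\in(0,1]$, and let $\hat y_s\sim\operatorname{Categorical}(\operatorname{softmax}(\alpha_s\vec z))$ and $\hat y_t\sim\operatorname{Categorical}(\operatorname{softmax}(\alpha_t\vec z))$ (unbiased cross-lingual error). Then $$\Pr(\hat y_t=y^{\text{mode}})\;\ge\;\frac{1}{1+(m-1)^{1-\gamma}\left(\dfrac{1-\Pr(\hat y_s=y^{\text{mode}})}{\Pr(\hat y_s=y^{\text{mode}})}\right)^{\gamma}},$$ and the right-hand side is a strictly increasing function of the source confidence: for fixed $m$ and $\gamma$, the function $c\mapsto \left(1+(m-1)^{1-\gamma}\left(\frac{1-c}{c}\right)^{\gamma}\right)^{-1}$ is strictly increasing on $(0,1)$.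
   Context: The response space is a finite set $\{1,\dots,m\}$ of normalized responses (concepts) shared by the source and target languages. For $\vec v\in\mathbb{R}^m$, $\operatorname{softmax}(\vec v)_k=\exp(\vec v[k])/\sum_{i=1}^m\exp(\vec v[i])$, and $\operatorname{Categorical}(p)$ is the distribution on $\{1,\dots,m\}$ assigning probability $p_k$ to $k$. In the unbiased case source and target responses use the same logit direction $\vec z$ with scales $\alpha_s$ and $\alpha_t$ respectively. The confidence in a language is the probability that a sampled response equals the mode: $\Pr(\hat y_s=y^{\text{mode}})$ for the source and $\Pr(\hat y_t=y^{\text{mode}})$ for the target. *)

(* Defs.v *)
From HB Require Import structures.
From mathcomp Require Import all_boot all_order all_algebra.
From mathcomp Require Import all_classical all_reals all_analysis.

Set Implicit Arguments.
Unset Strict Implicit.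
Unset Printing Implicit Defensive.

Import Order.TTheory GRing.Theory Num.Theory.
Import numFieldNormedType.Exports.

Local Open Scope classical_set_scope.
Local Open Scope ring_scope.

(* The response space {1, ..., m} is 'I_n.+1 with m = n.+1, since a
   measurableType must be inhabited; it carries the discrete sigma-algebra. *)
HB.instance Definition _ (n : nat) := isPointed.Build 'I_n.+1 ord0.

HB.instance Definition _ (n : nat) :=
  @isMeasurable.Build default_measure_display 'I_n.+1 discrete_measurable
    discrete_measurable0 discrete_measurableC discrete_measurableU.

(* The norm `|v| that the library puts on 'rV[R]_m is the sup norm, hence this
   explicit Euclidean norm. *)
Definition l2norm (R : rcfType) (m : nat) (v : 'rV[R]_m) : R :=
  Num.sqrt (\sum_(i < m) v 0 i ^+ 2).

Definition softmax (R : realType) (m : nat) (v : 'rV[R]_m) : 'rV[R]_m :=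
  \row_k (expR (v 0 k) / \sum_(i < m) expR (v 0 i)).

(* The finite sum of the point masses p_k; a probability measure as soon as p
   is a probability vector. *)
Definition categorical (R : realType) (m : nat) (p : 'rV[R]_m)
    (A : set 'I_m) : \bar R :=
  (\sum_(k < m | k \in A) (p 0 k)%:E)%E.

Definition has_law (d : measure_display) (Omega : measurableType d)
    (R : realType) (P : probability Omega R) (n : nat)
    (Y : {RV P >-> 'I_n.+1}) (mu : set 'I_n.+1 -> \bar R) : Prop :=
  forall A : set 'I_n.+1, distribution P Y A = mu A.

Definition confidence (d : measure_display) (Omega : measurableType d)
    (R : realType) (P : probability Omega R) (n : nat)
    (Y : {RV P >-> 'I_n.+1}) (y : 'I_n.+1) : R :=
  fine (P [set w | Y w = y]).

Definition confidence_bound (R : realType) (m : nat) (gamma c : R) : R :=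
  (1 + ((m%:R - 1) `^ (1 - gamma)) * (((1 - c) / c) `^ gamma))^-1.

(* Main.v *)
(* Put x_k = exp (alpha_s (z_k - z_ymode)).  The odds against the mode are the
   sum of the x_k over the m - 1 other responses k in the source, and the sum of
   the x_k ^ gamma in the target.  Since gamma <= 1, t |-> t ^ gamma is concave, so the
   second sum is at most (m - 1) ^ (1 - gamma) times the gamma-th power of the
   first. *)
Require Import Defs.
From HB Require Import structures.
From mathcomp Require Import all_boot all_order all_algebra.
From mathcomp Require Import all_classical all_reals all_analysis.

Set Implicit Arguments.
Unset Strict Implicit.
Unset Printing Implicit Defensive.

Import Order.TTheory GRing.Theory Num.Theory.
Import numFieldNormedType.Exports.

Local Open Scope classical_set_scope.
Local Open Scope ring_scope.

(** Young's inequality for [x]^ g[and]y [^ (1 - g)] with the conjugate exponents [g^-1] and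
    [(1 - g)^-1]. The second exponent degenerates at [g = 1], which is therefore treated apart. *)
Lemma powR_weighted_amgm (R : realType) (g x y : R) :
  0 < g <= 1 -> 0 <= x -> 0 <= y ->
  x `^ g * y `^ (1 - g) <= g * x + (1 - g) * y.
Proof.
move=> /andP[g0]; rewrite le_eqVlt => /predU1P[->|g1] x0 y0.
  by rewrite subrr powRr0 powRr1// mulr1 mul1r mul0r addr0.
have g10 : 0 < 1 - g by rewrite subr_gt0.
have := @conjugate_powR _ (x `^ g) (y `^ (1 - g)) g^-1 (1 - g)^-1
  (powR_ge0 _ _) (powR_ge0 _ _).
rewrite !invr_gt0 !invrK addrCA subrr addr0 => /(_ g0 g10 erefl).
by rewrite -!powRrM !mulfV ?gt_eqF// !powRr1// [x * g]mulrC [y * _]mulrC.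
Qed.

(** Jensen's inequality for the concave power, obtained by bounding each term by the tangent line at
    the mean [S / N]. *)
Lemma sum_powR_le (R : realType) (I : finType) (A : pred I) (x : I -> R)
    (g : R) :
  0 < g <= 1 -> (0 < #|A|)%N -> (forall i, 0 < x i) ->
  \sum_(i in A) x i `^ g <= #|A|%:R `^ (1 - g) * (\sum_(i in A) x i) `^ g.
Proof.
move=> g01 A0 x0; set S := \sum_(i in A) x i; set N : R := #|A|%:R.
have N0 : 0 < N by rewrite ltr0n.
have S0 : 0 < S.
  have /card_gt0P[i Ai] := A0; rewrite /S (bigD1 i)//=.
  by rewrite ltr_pwDl// sumr_ge0// => j _; exact: ltW.
have t0 : 0 < S / N by rewrite divr_gt0.
have -> : N `^ (1 - g) * S `^ g = S / (S / N) `^ (1 - g).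
  have SE : S `^ g * S `^ (1 - g) = S.
    rewrite -powRD; last by rewrite (gt_eqF S0) implybT.
    by rewrite addrCA subrr addr0 powRr1// ltW.
  have NE : N^-1 `^ (1 - g) = (N `^ (1 - g))^-1.
    by rewrite -powR_inv1 ?ltW// -powRrM mulN1r powRN.
  rewrite powRM ?invr_ge0 ?ltW// NE -{2}SE invfM invrK mulrA mulfK 1?mulrC//.
  by rewrite gt_eqF// powR_gt0.
rewrite ler_pdivlMr ?powR_gt0// mulr_suml.
have /le_trans : \sum_(i in A) x i `^ g * (S / N) `^ (1 - g) <=
    \sum_(i in A) (g * x i + (1 - g) * (S / N)).
  by apply: ler_sum => i _; rewrite powR_weighted_amgm// ltW.
(* The tangent bounds add up to [g * S + (1 - g) * (S / N) * N], which is exactly [S]. *)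
apply; rewrite big_split/= -mulr_sumr sumr_const -mulr_natr -/S -/N.
by rewrite -mulrA divfK ?gt_eqF// -mulrDl addrC subrK mul1r.
Qed.

(** Dividing the softmax through by its numerator [expR (v 0 y)] leaves 1 plus the odds against
    [y]. *)
Lemma confidence_softmax (d : measure_display) (Omega : measurableType d)
    (R : realType) (P : probability Omega R) (n : nat)
    (Y : {RV P >-> 'I_n.+1}) (v : 'rV[R]_n.+1) (y : 'I_n.+1) :
  has_law Y (categorical (softmax v)) ->
  confidence Y y = (1 + \sum_(k in predC1 y) expR (v 0 k - v 0 y))^-1.
Proof.
move=> /(_ [set y]); rewrite /categorical /distribution /pushforward.
have -> : Y @^-1` [set y] = [set w | Y w = y] by [].
rewrite /confidence => ->.
rewrite (big_pred1 y) => [|k]; last by apply/idP/eqP; rewrite inE.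
rewrite /= mxE -invf_div; congr (_^-1).
rewrite mulr_suml (bigD1 y)//= divff ?gt_eqF ?expR_gt0//; congr (_ + _).
by apply: eq_bigr => k _; rewrite expRB.
Qed.

Lemma confidence_bound_softmax_odds (R : realType) (m : nat) (g T : R) :
  0 < T ->
  confidence_bound m g (1 + T)^-1 = (1 + (m%:R - 1) `^ (1 - g) * T `^ g)^-1.
Proof.
move=> T0; have T1 : 1 + T != 0 by rewrite gt_eqF// addr_gt0.
rewrite /confidence_bound; congr (1 + _ * _ `^ _)^-1.
by rewrite invrK mulrBl mul1r mulVf// addrC addKr.
Qed.

(** The odds [(1 - c) / c = c^-1 - 1] strictly decrease in [c]; a positive power and a positive
    factor preserve this, and the outer inverse reverses it. The factor is positive because
    [1 < m]. *)
Lemma confidence_bound_homo_lt (R : realType) (m : nat) (g : R) :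
  (1 < m)%N -> 0 < g ->
  {in `]0, 1[%R &, {homo confidence_bound m g : c c' / c < c'}}.
Proof.
move=> m1 g0 c c'; rewrite !in_itv/= => /andP[c0 c1] /andP[c'0 c'1] cc'.
have odds0 e : 0 < e -> e < 1 -> 0 < (1 - e) / e.
  by move=> e0 e1; rewrite divr_gt0// subr_gt0.
have M0 : 0 < (m%:R - 1 : R) `^ (1 - g).
  by rewrite powR_gt0// subr_gt0 ltr1n.
have den0 e : 0 < e -> e < 1 -> 0 < 1 + (m%:R - 1) `^ (1 - g) * ((1 - e) / e) `^ g.
  by move=> e0 e1; rewrite addr_gt0// mulr_gt0// powR_gt0// odds0.
rewrite /confidence_bound ltf_pV2 ?posrE ?den0// ltrD2l ltr_pM2l//.
rewrite gt0_ltr_powR ?nnegrE ?ltW ?odds0//.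
by rewrite !mulrBl !mul1r !divff ?gt_eqF// ltrD2r ltf_pV2.
Qed.

Theorem proposition3 (R : realType) (n : nat) (hm : (2 <= n.+1)%N)
  (z : 'rV[R]_n.+1) (hz : l2norm z = 1)
  (ymode : 'I_n.+1) (hmode : forall k : 'I_n.+1, z 0 k <= z 0 ymode)
  (alpha_s alpha_t gamma : R) (hs : 0 < alpha_s) (ht : 0 < alpha_t)
  (hgamma : gamma = alpha_t / alpha_s) (hgamma01 : 0 < gamma <= 1)
  (d : measure_display) (Omega : measurableType d) (P : probability Omega R)
  (Ys Yt : {RV P >-> 'I_n.+1})
  (hYs : has_law Ys (categorical (softmax (alpha_s *: z))))
  (hYt : has_law Yt (categorical (softmax (alpha_t *: z)))) :
  confidence Yt ymode >= confidence_bound n.+1 gamma (confidence Ys ymode)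
  /\ {in `]0, 1[%R &, {homo confidence_bound n.+1 gamma : c c' / c < c'}}.
Proof.
have m1 : (1 < n.+1)%N := hm.
have /andP[g0 _] := hgamma01.
split; last exact: confidence_bound_homo_lt.
pose x k := expR (alpha_s * (z 0 k - z 0 ymode)).
have x0 k : 0 < x k by exact: expR_gt0.
have cA : #|predC1 ymode| = n by rewrite cardC1 card_ord.
have n0 : (0 < n)%N := m1.
have T0 : 0 < \sum_(k in predC1 ymode) x k.
  have /card_gt0P[i Ai] : (0 < #|predC1 ymode|)%N by rewrite cA.
  rewrite (bigD1 i)//= ltr_pwDl// sumr_ge0// => j _; exact: ltW.
have -> : confidence Ys ymode = (1 + \sum_(k in predC1 ymode) x k)^-1.
  rewrite (confidence_softmax _ hYs).
  by under eq_bigr do rewrite !mxE -mulrBr.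
have -> : confidence Yt ymode = (1 + \sum_(k in predC1 ymode) x k `^ gamma)^-1.
  rewrite (confidence_softmax _ hYt); congr (1 + _)^-1.
  (* Since [alpha_t = alpha_s * gamma], each target exponential is the source one raised to
     [gamma]. *)
  apply: eq_bigr => k _; rewrite !mxE -mulrBr -expRM hgamma; congr expR.
  by rewrite mulrC mulrAC [_ * (_ / _)]mulrC divfK ?gt_eqF// mulrC.
rewrite confidence_bound_softmax_odds// lef_pV2 ?posrE; last 2 first.
- by rewrite ltr_pwDl// mulr_ge0// powR_ge0.
- by rewrite ltr_pwDl// sumr_ge0// => k _; exact: powR_ge0.
rewrite lerD2l -natr1 addrK.
by have := sum_powR_le (A := predC1 ymode) hgamma01; rewrite cA; exact.
Qed.
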